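(* Let $\mathcal{K}=\{e,r,s,t\}$ be the Klein four-group and let $V = V_e \oplus V_r \oplus V_s \oplus V_t$ be a $\mathcal{K}$-graded vector space. Let $\sigma$ be a permutation of $\mathcal{K}$ satisfying $\sigma(ab)=\sigma(a)\sigma(b)$ for all $a,b\in\mathcal{K}$, and let $V' = V'_e\oplus V'_r\oplus V'_s\oplus V'_t$ be the $\mathcal{K}$-graded vector space whose underlying vector space equals that of $V$ but whose gradation is defined by $V'_k = V_{\sigma(k)}$ for all $k\in\mathcal{K}$. Then $\mathrm{End}(V)=\mathrm{End}(V')$. Furthermore, a homomorphism of degree $d$ in $\mathrm{End}(V)$ is a homomorphism of degree $\sigma^{-1}(d)$ in $\mathrm{End}(V')$.
   Context: All vector spaces are finite-dimensional over a field of characteristic zero. For a $\mathcal{K}$-graded vector space $V$, $\mathrm{End}(V)$ is the space of linear maps $V\to V$, graded by $\mathrm{End}(V)_d=\{f : f(V_b)\subset V_{db}\ \text{for all } b\in\mathcal{K}\}$, $d\in\mathcal{K}$; elements of $\mathrm{End}(V)_d$ are called homomorphisms of degree $d$. *)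

(* Defs.v *)
From HB Require Import structures.
From mathcomp Require Import all_boot all_order all_algebra all_fingroup.
Set Implicit Arguments. Unset Strict Implicit. Unset Printing Implicit Defensive.
Import GRing.Theory.
Local Open Scope ring_scope.

Inductive klein4 : Type := Ke | Kr | Ks | Kt.

Definition klein4_code (a : klein4) : bool * bool :=
  match a with
  | Ke => (false, false) | Kr => (true, false)
  | Ks => (false, true) | Kt => (true, true)
  end.

Definition klein4_decode (c : bool * bool) : klein4 :=
  match c with
  | (false, false) => Ke | (true, false) => Kr
  | (false, true) => Ks | (true, true) => Kt
  end.

Lemma klein4_codeK : cancel klein4_code klein4_decode.
Proof. by case. Qed.

HB.instance Definition _ := Finite.copy klein4 (can_type klein4_codeK).

Definition klein4_mul (a b : klein4) : klein4 :=
  match a, b with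
  | Ke, x | x, Ke => x
  | Kr, Kr | Ks, Ks | Kt, Kt => Ke
  | Kr, Ks | Ks, Kr => Kt
  | Kr, Kt | Kt, Kr => Ks
  | Ks, Kt | Kt, Ks => Kr
  end.

Lemma klein4_mulA : associative klein4_mul.
Proof. by do 3! case. Qed.

Lemma klein4_mul1g : left_id Ke klein4_mul.
Proof. by case. Qed.

Lemma klein4_mulVg : left_inverse Ke id klein4_mul.
Proof. by case. Qed.

HB.instance Definition _ :=
  Finite_isGroup.Build klein4 klein4_mulA klein4_mul1g klein4_mulVg.

(* [directv] asserts that the sum is direct; [kgfull] that it is everything. *)
Record kgraded (F : fieldType) := KGraded {
  kgsort :> vectType F;
  kgcomp : klein4 -> {vspace kgsort};
  kgdirect : directv (\sum_(k : klein4) kgcomp k);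
  kgfull : (\sum_(k : klein4) kgcomp k)%VS = fullv
}.

Section Regrade.
Variables (F : fieldType) (V : kgraded F) (s : {perm klein4}).

Lemma regrade_direct : directv (\sum_(k : klein4) kgcomp V (s k)).
Proof.
apply/directv_sum_independent => us usV us0 i _.
have /directv_sum_independent dV := kgdirect V.
rewrite -[i](permK s); apply: (dV (fun k => us (s^-1%g k))) => // [k _|].
  by rewrite -{2}[k](permKV s); apply: usV.
rewrite (reindex_inj (@perm_inj _ s)) /= -[RHS]us0.
by apply: eq_bigr => k _; rewrite permK.
Qed.

Lemma regrade_full : (\sum_(k : klein4) kgcomp V (s k))%VS = fullv.
Proof. by rewrite -(kgfull V) [RHS](reindex_inj (@perm_inj _ s)). Qed.

Definition regrade : kgraded F :=
  @KGraded F (kgsort V) (fun k => kgcomp V (s k)) regrade_direct regrade_full.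
End Regrade.

Section EndGrading.
Variables (F : fieldType) (V : kgraded F).

Definition homdeg (d : klein4) (f : 'End(V)) : bool :=
  [forall b, (f @: kgcomp V b <= kgcomp V (d * b)%g)%VS].

Lemma homdegP d (f : 'End(V)) :
  reflect (forall b v, v \in kgcomp V b -> f v \in kgcomp V (d * b)%g)
          (homdeg d f).
Proof.
apply: (iffP forallP) => [fd b v vb | fd b].
  by apply: (subvP (fd b)); apply: memv_img.
by apply/subvP => _ /memv_imgP[v vb ->]; apply: fd.
Qed.

Lemma endcomp_sig d :
  {U : {vspace 'End(V)} | forall f : 'End(V), (f \in U) = homdeg d f}.
Proof.
pose g b (f : 'End(V)) : 'End(V) :=
  ((\1 - projv (kgcomp V (d * b)%g)) \o (f \o projv (kgcomp V b)))%VF.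
have gl b : linear (g b).
  move=> a f h; apply/lfunP => v; rewrite /g add_lfunE scale_lfunE.
  by rewrite !comp_lfunE [(a *: f + h) _]add_lfunE scale_lfunE linearP.
pose G b : {linear 'End(V) -> 'End(V)} :=
  HB.pack (g b) (GRing.isLinear.Build _ _ _ _ (g b) (gl b)).
exists (\bigcap_b lker (linfun (G b)))%VS => f.
rewrite memvE; apply/subv_bigcapP/homdegP => [fd b v vb | fd b _].
  have := fd b isT; rewrite -memvE memv_ker lfunE /= => /eqP/lfunP/(_ v).
  rewrite !comp_lfunE add_lfunE opp_lfunE id_lfunE zero_lfunE projv_id //.
  by move/eqP; rewrite subr_eq0 => /eqP ->; apply: memv_proj.
rewrite -memvE memv_ker lfunE /=; apply/eqP/lfunP => v.
rewrite !comp_lfunE add_lfunE opp_lfunE id_lfunE zero_lfunE.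
by rewrite [X in _ - X]projv_id ?subrr //; apply/fd/memv_proj.
Qed.

Definition endcomp (d : klein4) : {vspace 'End(V)} := sval (endcomp_sig d).

Lemma endcompE d (f : 'End(V)) : (f \in endcomp d) = homdeg d f.
Proof. by rewrite /endcomp; case: (endcomp_sig d). Qed.

Lemma endcomp_direct : directv (\sum_(d : klein4) endcomp d).
Proof.
apply/directv_sum_independent => f fd f0 d _; apply/lfunP => v.
have: v \in (\sum_(k : klein4) kgcomp V k)%VS by rewrite kgfull memvf.
case/memv_sumP => vs vsV ->; rewrite linear_sum lfunE /= big1 // => b _.
have /directv_sum_independent dV := kgdirect V.
rewrite -[d](mulgK b); apply: (dV (fun k => f (k * b^-1)%g (vs b))) => // [k _|].
  have := fd (k * b^-1)%g isT; rewrite endcompE => /homdegP/(_ b _ (vsV b isT)).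
  by rewrite mulgKV.
rewrite (reindex_inj (mulIg b)) /=.
transitivity ((\sum_d f d) (vs b)); last by rewrite f0 lfunE.
by rewrite sum_lfunE; apply: eq_bigr => k _; rewrite mulgK.
Qed.

Lemma endcomp_full : (\sum_(d : klein4) endcomp d)%VS = fullv.
Proof.
apply/eqP; rewrite eqEsubv subvf /=; apply/subvP => f _.
pose p b : 'End(V) := sumv_pi_for (esym (kgfull V)) b.
have pV b v : p b v \in kgcomp V b by apply: memv_sum_pi.
have p1 v : \sum_b p b v = v by apply: sumv_pi_sum; apply: memvf.
have p0 b c v : v \in kgcomp V c -> p b v = if b == c then v else 0.
  move=> vc; have /directv_sum_unique dV := kgdirect V.
  have := dV (fun k => p k v) (fun k => if k == c then v else 0)
    (fun k _ => pV k v).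
  have uV k : (if k == c then v else 0) \in kgcomp V k.
    by case: eqP => [->|_]; rewrite ?mem0v.
  by move=> /(_ (fun k _ => uV k)); rewrite p1 -big_mkcond big_pred1_eq eqxx
    => /esym/forallP/(_ b)/eqP.
apply/memv_sumP; exists (fun d => \sum_b (p (d * b)%g \o (f \o p b))%VF).
  move=> d _; rewrite endcompE; apply/homdegP => c v vc.
  rewrite sum_lfunE (bigD1 c) //= big1 ?addr0 => [|b bc].
    by rewrite comp_lfunE.
  by rewrite !comp_lfunE (p0 b c) // (negPf bc) !linear0.
apply/lfunP => v; rewrite sum_lfunE.
under eq_bigr do rewrite sum_lfunE.
rewrite exchange_big /= -{1}[v]p1 linear_sum; apply: eq_bigr => b _.
rewrite /= -[f (p b v)]p1 (reindex_inj (mulIg b)) /=.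
by apply: eq_bigr => d _; rewrite !comp_lfunE.
Qed.

Definition kgEnd : kgraded F :=
  @KGraded F 'End(V) endcomp endcomp_direct endcomp_full.
End EndGrading.

(* Main.v *)
Require Import Defs.
From mathcomp Require Import all_boot all_order all_algebra all_fingroup.
Local Open Scope ring_scope.

(** The space [End(V)] does not see the gradation of [V], so both endomorphism
    algebras are the full space of linear maps, and the homogeneous components
    of either gradation sum to it.  For the degrees, the component of index [b]
    of [V'] is that of index [sigma b] of [V], so [f] has degree [c] on [V']
    when it maps [V_(sigma b)] into [V_(sigma (c * b))] for all [b].  As [sigma]
    is multiplicative, the target is [V_(sigma c * sigma b)]; and [sigma b] runs
    over the whole group, so this says that [f] has degree [sigma c] on [V]. *)

(** Multiplicativity turns the conditions for the two gradations into the same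
    family of inclusions, the one for [V'] at [b] being the one for [V] at
    [sigma b]; this is why the degrees correspond in both directions. *)
Lemma homdeg_regrade (F : fieldType) (V : kgraded F) (sigma : {perm klein4})
    (sigmaM : {morph sigma : a b / (a * b)%g}) (c : klein4) (f : 'End(V)) :
  @homdeg F (regrade V sigma) c f = @homdeg F V (sigma c) f.
Proof.
apply/forallP/forallP => fV b; last by rewrite /= sigmaM; apply: fV.
by have := fV (sigma^-1 b)%g; rewrite /= sigmaM permKV.
Qed.

Theorem proposition7p6 (F : fieldType) (charF0 : [pchar F] =i pred0)
    (V : kgraded F) (sigma : {perm klein4})
    (sigmaM : forall a b : klein4, sigma (a * b)%g = (sigma a * sigma b)%g) :
  let V' := regrade V sigma in
  [/\ kgsort (kgEnd V) = kgsort (kgEnd V'),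
      (\sum_(d : klein4) kgcomp (kgEnd V) d)%VS
        = (\sum_(d : klein4) kgcomp (kgEnd V') d)%VS
    & forall (d : klein4) (f : 'End(V)),
        f \in kgcomp (kgEnd V) d -> f \in kgcomp (kgEnd V') (sigma^-1%g d)].
Proof.
move=> V'; split=> [//||d f].
  by rewrite (kgfull (kgEnd V)) (kgfull (kgEnd V')).
by rewrite /= (@endcompE F V) (@endcompE F V') homdeg_regrade // permKV.
Qed.
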